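(* Let $\mathcal H,\widehat{\mathcal H}_1,\dots,\widehat{\mathcal H}_L$ be separable Hilbert spaces. Let $A$ be a self-adjoint operator in $\mathcal H$ with compact resolvent and bounded from below, $A\ge a$ for some $a\in\mathbb R$, let $B_\ell:\widehat{\mathcal H}_\ell\to\mathcal H$ be bounded linear operators with the same closed range, $\operatorname{ran}B_\ell=:\mathcal H_0\subset\mathcal H$, $\ell=1,2,\dots,L$, and let $c_1,\dots,c_L\in\mathbb R$ with $c_1<c_2<\dots<c_L$. Let $$\mathcal S(\lambda)=A-\lambda-\sum_{\ell=1}^L\frac{B_\ell B_\ell^*}{c_\ell-\lambda},\quad\operatorname{dom}\mathcal S(\lambda)=\operatorname{dom}A,\quad\lambda\in\mathbb C\setminus\{c_1,\dots,c_L\}.$$ Then there exist $\gamma_\ell^\pm>0$ such that $$\gamma_\ell^-\|u_0\|^2\le\|B_\ell^*u\|^2\le\gamma_\ell^+\|u_0\|^2,\quad u=u_0+u_0'\in\mathcal H_0\oplus\mathcal H_0^\perp,\quad\ell=1,2,\dots,L.$$ Furthermore, for such $\gamma_\ell^\pm$ and for $\ell\in\{1,2,\dots,L\}$, with $$\psi_\ell(\lambda):=\sum_{k=1}^\ell\frac{\gamma_k^-}{c_k-\lambda}+\sum_{k=\ell+1}^L\frac{\gamma_k^+}{c_k-\lambda},\quad\lambda\in\mathbb R\setminus\{c_1,\dots,c_L\},$$ the following hold: (i) If $a>c_{\ell+1}$ and $\eta_\ell$ is the unique zero of $\psi_\ell$ in $(c_\ell,c_{\ell+1})$, then $(c_\ell,\eta_\ell)\subset\rho(\mathcal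 S)$. (ii) If $\mathcal H_0=\mathcal H$ and $\eta_\ell'$ is the unique zero of the function $\lambda\mapsto a-\lambda-\psi_\ell(\lambda)$ in $(c_\ell,c_{\ell+1})$, then $(c_\ell,\eta_\ell')\subset\rho(\mathcal S)$.
   Context: Convention: $c_{L+1}:=+\infty$ (so (i) is void for $\ell=L$). $\rho(\mathcal S)=\{\lambda\in\mathbb C\setminus\{c_1,\dots,c_L\}:0\in\rho(\mathcal S(\lambda))\}$, i.e. the set of $\lambda$ for which $\mathcal S(\lambda)$ is boundedly invertible. *)

(* Defs.v *)
From HB Require Import structures.
From mathcomp Require Import all_boot all_order all_algebra.
From mathcomp Require Import sesquilinear complex.
From mathcomp Require Import all_classical all_reals all_analysis.
Set Implicit Arguments.
Unset Strict Implicit.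
Unset Printing Implicit Defensive.
Import Order.TTheory GRing.Theory Num.Theory.
Import numFieldNormedType.Exports.
Local Open Scope classical_set_scope.
Local Open Scope ring_scope.
Local Open Scope complex_scope.

(* The inner product is linear in its first argument and conjugate-linear in
   the second one. Norms on a module over R[i] take values in R[i]. *)
HB.mixin Record CompleteNormedModule_isHilbert (R : realType) H
    of CompleteNormedModule R[i] H := {
  inner : {dot H for (Num.conj : R[i] -> R[i])} ;
  inner_normE : forall u : H, inner u u = `|u| ^+ 2
}.

#[short(type="hilbertType")]
HB.structure Definition Hilbert (R : realType) :=
  {H of CompleteNormedModule R[i] H & CompleteNormedModule_isHilbert R H}.

Notation "''[' u , v ]" := (inner u v) : ring_scope.

Definition separable (T : topologicalType) : Prop :=
  exists D : set T, countable D /\ dense D.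

Definition orthocomplement (R : realType) (H : hilbertType R) (V : set H)
  : set H := [set u | forall v, V v -> '[u, v] = 0].

(* For continuous linear B, the vector chosen here exists and is unique by the
   Riesz representation theorem, so the default value of get is not used. *)
Definition adjoint (R : realType) (H1 H2 : hilbertType R)
  (B : {linear H1 -> H2}) (v : H2) : H1 :=
  get [set w : H1 | forall u : H1, '[B u, v] = '[u, w]].

Section UnboundedOperators.
Context (R : realType) (H : hilbertType R).

(* The values of op_fun outside of op_dom are irrelevant. *)
Record operator := Operator { op_dom : set H ; op_fun : H -> H }.

Definition linear_operator (T : operator) : Prop :=
  [/\ op_dom T 0,
      (forall (k : R[i]) u v, op_dom T u -> op_dom T v ->
         op_dom T (k *: u + v)) &
      (forall (k : R[i]) u v, op_dom T u -> op_dom T v ->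
         op_fun T (k *: u + v) = k *: op_fun T u + op_fun T v)].

Definition op_graph (T : operator) : set (H * H) :=
  [set p | op_dom T p.1 /\ p.2 = op_fun T p.1].

Definition adjoint_graph (T : operator) : set (H * H) :=
  [set p | forall u, op_dom T u -> '[op_fun T u, p.1] = '[u, p.2]].

Definition self_adjoint (T : operator) : Prop :=
  [/\ linear_operator T, dense (op_dom T) & adjoint_graph T = op_graph T].

(* The order on R[i] compares only numbers with the same imaginary part; in
   particular the quadratic form takes real values. *)
Definition bounded_below_by (T : operator) (a : R) : Prop :=
  forall u, op_dom T u -> a%:C * `|u| ^+ 2 <= '[op_fun T u, u].

Definition op_shift (T : operator) (z : R[i]) : operator :=
  Operator (op_dom T) (fun u => op_fun T u - z *: u).

Definition bounded_inverse (T : operator) (J : {linear H -> H}) : Prop :=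
  [/\ continuous J,
      (forall v, op_dom T (J v) /\ op_fun T (J v) = v) &
      (forall u, op_dom T u -> J (op_fun T u) = u)].

Definition resolvent_set (T : operator) : set R[i] :=
  [set z | exists J : {linear H -> H}, bounded_inverse (op_shift T z) J].

Definition compact_operator (J : {linear H -> H}) : Prop :=
  precompact (J @` [set u : H | `|u| <= 1]).

Definition compact_resolvent (T : operator) : Prop :=
  exists (z : R[i]) (J : {linear H -> H}),
    bounded_inverse (op_shift T z) J /\ compact_operator J.

End UnboundedOperators.

Section OperatorFunction.
Context (R : realType) (L : nat).
Context (H : hilbertType R) (Hh : 'I_L -> hilbertType R).
Context (A : operator H) (B : forall l, {linear Hh l -> H}) (c : 'I_L -> R).

Definition opS (lam : R[i]) : operator H :=
  Operator (op_dom A) (fun u => op_fun A u - lam *: u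
    - \sum_(l < L) ((c l)%:C - lam)^-1 *: B l (adjoint (B l) u)).

Definition opS_resolvent_set : set R[i] :=
  [set lam | (forall l, lam != (c l)%:C) /\ resolvent_set (opS lam) 0].

Definition gamma_bounds (H0 : set H) (gm gp : 'I_L -> R) : Prop :=
  (forall l, 0 < gm l /\ 0 < gp l) /\
  (forall l (u0 u0' : H), H0 u0 -> orthocomplement H0 u0' ->
     (gm l)%:C * `|u0| ^+ 2 <= `|adjoint (B l) (u0 + u0')| ^+ 2
                            <= (gp l)%:C * `|u0| ^+ 2).

End OperatorFunction.

Section ScalarFunctions.
Context (R : realType) (L : nat) (c : 'I_L -> R).

Definition psi (gm gp : 'I_L -> R) (l : 'I_L) (lam : R) : R :=
  \sum_(k < L | (k <= l)%N) gm k / (c k - lam)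
  + \sum_(k < L | (l < k)%N) gp k / (c k - lam).

Definition next_c (l : 'I_L) : \bar R :=
  if insub l.+1 is Some k then (c k)%:E else +oo%E.

Definition gap (l : 'I_L) : set R :=
  [set x | ((c l)%:E < x%:E < next_c l)%E].

End ScalarFunctions.

Definition unique_zero_in (R : realType) (I : set R) (f : R -> R) (x : R) :=
  [/\ I x, f x = 0 & forall y, I y -> f y = 0 -> y = x].

(* Main.v *)
Require Import Defs.
From HB Require Import structures.
From mathcomp Require Import all_boot all_order all_algebra.
From mathcomp Require Import sesquilinear complex.
From mathcomp Require Import all_classical all_reals all_analysis.
From mathcomp Require Import ring lra.
Set Implicit Arguments.
Unset Strict Implicit.
Unset Printing Implicit Defensive.
Import Order.TTheory GRing.Theory Num.Theory.
Import numFieldNormedType.Exports.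
Local Open Scope classical_set_scope.
Local Open Scope ring_scope.
Local Open Scope complex_scope.

(* On (c_l, c_(l+1)) the terms with k <= l have negative denominators, so for
   u = u0 + u0' the bounds on |B_k^* u| give
     <S(x) u, u> >= (a - x) |u|^2 - psi_l(x) |u0|^2.
   As psi_l is increasing there, the right-hand side is at least d |u|^2 with
   d = a - x > 0 in case (i), and d = a - x - psi_l(x) > 0 in case (ii), where
   u0 = u. Since S(x) is A plus a bounded symmetric operator, it is self-adjoint,
   and a self-adjoint operator with such a lower bound has closed range with
   trivial orthogonal complement, hence a bounded inverse.
   The constants gamma_l^- come from the closed range of B_l by uniform
   boundedness. *)

(** * The underlying real inner product, Cauchy-Schwarz, and sequential limits *)

Section RealStructure.
Context (R : realType) (H : hilbertType R).
Implicit Types (u v w : H) (t : R).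

(** Norms on H take values in R[i]; passing to real parts moves every estimate to the real field
    [R], where [lra] and [nra] apply. *)
Definition rnorm u : R := complex.Re `|u|.
Definition rip u v : R := complex.Re '[u, v].

Lemma rnormE u : `|u| = (rnorm u)%:C.
Proof. by rewrite /rnorm RRe_real ?normr_real. Qed.

Lemma rnorm_ge0 u : 0 <= rnorm u.
Proof. by rewrite -lecR -rnormE normr_ge0. Qed.

Lemma rnorm0 : rnorm 0 = 0.
Proof. by rewrite /rnorm normr0. Qed.

Lemma rnorm0_eq0 u : rnorm u = 0 -> u = 0.
Proof. by move=> u0; apply/eqP; rewrite -normr_eq0 rnormE u0. Qed.

Lemma rnorm_triangle u v : rnorm (u + v) <= rnorm u + rnorm v.
Proof. by rewrite -lecR rmorphD/= -!rnormE ler_normD. Qed.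

Lemma rnormN u : rnorm (- u) = rnorm u.
Proof. by rewrite /rnorm normrN. Qed.

Lemma rnorm_distC u v : rnorm (u - v) = rnorm (v - u).
Proof. by rewrite /rnorm distrC. Qed.

Lemma rnormZ t u : rnorm (t%:C *: u) = `|t| * rnorm u.
Proof.
apply: (@complexI R); rewrite rmorphM/= -!rnormE normrZ normc_def /= expr0n/=.
by rewrite addr0 sqrtr_sqr.
Qed.

Lemma innerDl u v w : '[u + v, w] = '[u, w] + '[v, w].
Proof. exact: linearDl. Qed.
Lemma innerDr u v w : '[w, u + v] = '[w, u] + '[w, v].
Proof. exact: linearDr. Qed.
Lemma innerBr u v w : '[w, u - v] = '[w, u] - '[w, v].
Proof. exact: linearBr. Qed.
Lemma innerNl u v : '[- u, v] = - '[u, v].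
Proof. exact: linearNl. Qed.
Lemma innerNr u v : '[u, - v] = - '[u, v].
Proof. exact: linearNr. Qed.
Lemma innerZl (k : R[i]) u v : '[k *: u, v] = k * '[u, v].
Proof. exact: linearZl_LR. Qed.
Lemma innerZr (k : R[i]) u v : '[u, k *: v] = conjc k * '[u, v].
Proof. exact: linearZr_LR. Qed.
Lemma innerC u v : '[u, v] = conjc '[v, u].
Proof. by rewrite (hermC (inner (s := H)) u v) expr0 mul1r. Qed.

Lemma ripC u v : rip u v = rip v u.
Proof. by rewrite /rip innerC; case: '[v, u]. Qed.
Lemma ripDl u v w : rip (u + v) w = rip u w + rip v w.
Proof. by rewrite /rip innerDl; case: '[u, w]; case: '[v, w]. Qed.
Lemma ripZl t u v : rip (t%:C *: u) v = t * rip u v.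
Proof. by rewrite /rip innerZl; case: '[u, v] => x y /=; rewrite mul0r subr0. Qed.
Lemma ripDr u v w : rip w (u + v) = rip w u + rip w v.
Proof. by rewrite ripC ripDl !(ripC w). Qed.
Lemma ripZr t u v : rip u (t%:C *: v) = t * rip u v.
Proof. by rewrite ripC ripZl ripC. Qed.
Lemma ripNl u v : rip (- u) v = - rip u v.
Proof. by have := ripZl (-1) u v; rewrite rmorphN1 scaleN1r mulN1r. Qed.
Lemma ripNr u v : rip u (- v) = - rip u v.
Proof. by rewrite ripC ripNl ripC. Qed.
Lemma rip0l u : rip 0 u = 0.
Proof. by have := ripZl 0 u u; rewrite rmorph0 scale0r mul0r. Qed.
Lemma ripuu u : rip u u = rnorm u ^+ 2.
Proof.
by rewrite /rip inner_normE rnormE -rmorphXn.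
Qed.

Definition ripE := (ripDl, ripDr, ripNl, ripNr, ripZl, ripZr).

(** Since the second argument is conjugate-linear, Re <u, i v> is the imaginary part of <u, v>;
    complex identities thus reduce to pairs of real ones. *)
Lemma inner_eqP u v u' v' : '[u, v] = '[u', v'] <->
  rip u v = rip u' v' /\ rip u ('i%C *: v) = rip u' ('i%C *: v').
Proof.
rewrite /rip !innerZr; case: '[u, v] => x y; case: '[u', v'] => x' y' /=.
rewrite !mul0r !mulN1r !sub0r !opprK; split => [[-> ->]//|[-> ->]//].
Qed.

Lemma inner_eq0P u v : '[u, v] = 0 <-> rip u v = 0 /\ rip u ('i%C *: v) = 0.
Proof.
rewrite /rip !innerZr; case: '[u, v] => x y /=.
rewrite !mul0r !mulN1r !sub0r !opprK; split => [[-> ->]//|[-> ->]//].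
Qed.

Lemma parallelogram u v :
  rnorm (u + v) ^+ 2 + rnorm (u - v) ^+ 2 = 2 * rnorm u ^+ 2 + 2 * rnorm v ^+ 2.
Proof. rewrite -!ripuu !ripE (ripC v u); ring. Qed.

(** Cauchy-Schwarz: the squared norm of |v| u - |u| v is nonnegative and expands to 2 |u| |v| (|u|
    |v| - <u, v>). *)
Lemma rip_le u v : rip u v <= rnorm u * rnorm v.
Proof.
have [v0|v0] := eqVneq (rnorm v) 0.
  by rewrite (rnorm0_eq0 v0) ripC rip0l rnorm0 mulr0.
have vgt0 : 0 < rnorm v by rewrite lt_neqAle eq_sym v0 rnorm_ge0.
have [u0|u0] := eqVneq (rnorm u) 0.
  by rewrite (rnorm0_eq0 u0) rip0l rnorm0 mul0r.
have ugt0 : 0 < rnorm u by rewrite lt_neqAle eq_sym u0 rnorm_ge0.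
have : 0 <= rnorm ((rnorm v)%:C *: u - (rnorm u)%:C *: v) ^+ 2 by exact: sqr_ge0.
rewrite -ripuu !ripE !ripuu (ripC v u) => h.
have : 0 <= (rnorm u * rnorm v) * (rnorm u * rnorm v - rip u v) by nra.
by rewrite pmulr_rge0 ?mulr_gt0// subr_ge0.
Qed.

Lemma rip_abs_le u v : `|rip u v| <= rnorm u * rnorm v.
Proof. by rewrite ler_norml rip_le lerNl -ripNl -(rnormN u) rip_le. Qed.

Definition seq_cvg (x : nat -> H) (l : H) : Prop :=
  forall e : R, 0 < e -> exists N, forall n, (N <= n)%N -> rnorm (x n - l) < e.

Definition seq_cauchy (x : nat -> H) : Prop :=
  forall e : R, 0 < e -> exists N, forall m n, (N <= m)%N -> (N <= n)%N ->
    rnorm (x m - x n) < e.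

Definition seq_closed (V : set H) : Prop :=
  forall x l, (forall n, V (x n)) -> seq_cvg x l -> V l.

(** A positive element of R[i] has zero imaginary part, so the epsilons of the library's topology on
    H can be taken real. *)
Lemma gt0_complex (e : R[i]) : 0 < e -> exists2 r : R, 0 < r & e = r%:C.
Proof.
move=> e0; exists (complex.Re e); last by rewrite RRe_real// gtr0_real.
by rewrite -ltcR RRe_real// gtr0_real.
Qed.

Lemma seq_cvgP (x : nat -> H) (l : H) : seq_cvg x l <-> x @ \oo --> l.
Proof.
split.
- move=> xl; apply/cvgrPdist_lt => e /gt0_complex[r r0 ->].
  have [N xN] := xl _ r0; exists N => // n /= Nn.
  by rewrite rnormE ltcR rnorm_distC xN.
- move=> /cvgrPdist_lt xl e e0.
  have /xl : 0 < e%:C by rewrite ltcR.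
  move=> [N _ xN]; exists N => n Nn.
  by have := xN _ Nn; rewrite rnormE ltcR rnorm_distC.
Qed.

Lemma seq_cauchy_cvg (x : nat -> H) : seq_cauchy x -> exists l, seq_cvg x l.
Proof.
move=> cx; exists (lim (x @ \oo)); apply/seq_cvgP.
apply: cauchy_cvg; apply/cauchy_ballP => e /gt0_complex[r r0 ->].
have [N xN] := cx _ r0.
exists (x @` [set n | (N <= n)%N], x @` [set n | (N <= n)%N]) => /=.
  split; exists N => // n /= Nn; by exists n.
move=> [_ _] /= [[m Nm <-] [n Nn <-]].
by rewrite -ball_normE /ball_/= rnormE ltcR xN.
Qed.

Lemma closed_seq_closed (V : set H) : closed V -> seq_closed V.
Proof.
move=> cV x l Vx /seq_cvgP xl.
by apply: (closed_cvg V cV _ l xl); apply: nearW => n; exact: Vx.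
Qed.

Lemma seq_cvg_cauchy x l : seq_cvg x l -> seq_cauchy x.
Proof.
move=> xl e e0; have e2 : 0 < e / 2 by lra.
have [N xN] := xl _ e2; exists N => m n Nm Nn.
have -> : x m - x n = (x m - l) + (l - x n) by rewrite addrA subrK.
have := rnorm_triangle (x m - l) (l - x n).
have := xN _ Nm; have := xN _ Nn; rewrite (rnorm_distC l); lra.
Qed.

Lemma rip_const_cvg (x : nat -> H) l v r :
  seq_cvg x l -> (forall n, rip (x n) v = r) -> rip l v = r.
Proof.
move=> xl xv; apply/eqP; rewrite -subr_eq0 -normr_le0; apply/ler_addgt0Pr => e e0.
(* The summand 1 keeps the denominator positive when [v] is 0. *)
have e1 : 0 < e / (rnorm v + 1) by rewrite divr_gt0// ltr_wpDl// rnorm_ge0.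
have [N /(_ N (leqnn N)) xN] := xl _ e1.
have -> : rip l v - r = - rip (x N - l) v by rewrite !ripE xv opprB.
rewrite normrN add0r (le_trans (rip_abs_le _ _))//.
apply: (@le_trans _ _ (e / (rnorm v + 1) * (rnorm v + 1))).
  by apply: ler_pM => //; rewrite ?rnorm_ge0 ?ltW// ltrDl.
by rewrite divfK// gt_eqF// ltr_wpDl// rnorm_ge0.
Qed.

End RealStructure.

(** * Continuity of linear maps as a real operator bound *)

Section BoundedLinear.
Context (R : realType) (H1 H2 : hilbertType R).

Lemma continuous_rnorm_bound (B : {linear H1 -> H2}) : continuous B ->
  exists2 M : R, 0 < M & forall u, rnorm (B u) <= M * rnorm u.
Proof.
move=> /(_ 0) /continuous_linear_bounded /linear_boundedP[M [Mreal BM]].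
have [r Mr] : exists r : R, M < r%:C /\ 0 < r.
  (* The bound holds for constants strictly above [M], which itself may be negative. *)
  exists (`|complex.Re M| + 1); split; last by rewrite ltr_wpDl.
  by rewrite -(RRe_real Mreal) ltcR ltr_pwDr// ler_norm.
exists r; first by case: Mr.
move=> u; rewrite -lecR rmorphM/= -!rnormE; apply: BM; by case: Mr.
Qed.

Lemma rnorm_bound_continuous (B : {linear H1 -> H2}) (M : R) :
  (forall u, rnorm (B u) <= M * rnorm u) -> continuous B.
Proof.
move=> BM; apply: bounded_linear_continuous; apply/linear_boundedP.
exists M%:C; split; first by rewrite complex_real.
move=> k Mk u; rewrite (@le_trans _ _ (M%:C * `|u|))//.
  by rewrite !rnormE -rmorphM lecR.
by rewrite ler_wpM2r// ltW.
Qed.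

End BoundedLinear.

(** * Orthogonal projection onto closed subspaces and Riesz representation *)

Section Projection.
Context (R : realType) (H : hilbertType R).
Implicit Types (u v w : H) (V : set H).

Definition subspace V : Prop :=
  V 0 /\ forall (k : R[i]) u v, V u -> V v -> V (k *: u + v).

Lemma subspaceZ V k u : subspace V -> V u -> V (k *: u).
Proof. by move=> [V0 VP] Vu; rewrite -(addr0 (k *: u)); exact: VP. Qed.

Lemma subspaceD V u v : subspace V -> V u -> V v -> V (u + v).
Proof. by move=> [V0 VP] Vu Vv; rewrite -(scale1r u); exact: VP. Qed.

(** A minimizing sequence for the distance to [V] is Cauchy, and closedness keeps its limit in
    [V]. *)
Lemma exists_nearest V (x : H) : subspace V -> seq_closed V ->
  exists2 p, V p & forall v, V v -> rnorm (x - p) <= rnorm (x - v).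
Proof.
move=> sV cV; have V0 := sV.1.
pose S : set R := [set rnorm (x - v) ^+ 2 | v in V].
have S0 : S !=set0 by exists (rnorm (x - 0) ^+ 2); exists 0.
have Slb : has_lbound S by exists 0 => _ [v Vv <-]; exact: sqr_ge0.
have hiS : has_inf S by [].
pose d := inf S.
have dle v : V v -> d <= rnorm (x - v) ^+ 2 by move=> Vv; apply: ge_inf => //; exists v.
have vex (n : nat) : exists v, V v /\ rnorm (x - v) ^+ 2 < d + n.+1%:R^-1.
  have [|_ [v Vv <-] h] := @inf_adherent _ S n.+1%:R^-1 _ hiS; first by rewrite invr_gt0.
  by exists v.
have [f fP] := choice vex.
have half_mem u v : V u -> V v -> V ((2^-1)%:C *: (u + v)).
  by move=> Vu Vv; apply: subspaceZ => //; exact: subspaceD.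
(* Parallelogram law for x - f m and x - f n: their half-sum is x minus a
   point of V, hence has squared norm at least d. *)
have close m n : rnorm (f m - f n) ^+ 2 <= 2 * (m.+1%:R^-1 + n.+1%:R^-1).
  have [Vm xm] := fP m; have [Vn xn] := fP n.
  have := parallelogram (x - f m) (x - f n).
  have -> : x - f m + (x - f n) = 2%:C *: (x - (2^-1)%:C *: (f m + f n)).
    rewrite scalerBr scalerA -rmorphM/= mulfV// scale1r.
    have -> : (2%:C : R[i]) = 2 by rewrite rmorph_nat.
    by rewrite scaler_nat mulr2n opprD addrACA.
  have -> : x - f m - (x - f n) = - (f m - f n).
    by rewrite !opprB addrC addrA subrK.
  rewrite rnormN rnormZ exprMn ger0_norm//.
  have := dle _ (half_mem _ _ Vm Vn); move: xm xn.
  move: (m.+1%:R^-1) (n.+1%:R^-1) (rnorm (x - f m)) (rnorm (x - f n)).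
  move: (rnorm (f m - f n)) (rnorm (x - _)) => r1 r2 r3 r4 r5 r6.
  lra.
have cf : seq_cauchy f.
  move=> e e0.
  have [N _ hN] : \forall n \near \oo, n.+1%:R^-1 < e ^+ 2 / 4 :> R.
    by apply: near_infty_natSinv_lt (PosNum _); rewrite divr_gt0// exprn_gt0.
  exists N => m n Nm Nn; have := close m n; have := hN _ Nm; have := hN _ Nn => /= h1 h2 h3.
  rewrite ltNge; apply/negP => h.
  have : e ^+ 2 <= rnorm (f m - f n) ^+ 2 by rewrite lerXn2r// nnegrE ?rnorm_ge0 ?ltW.
  move: h1 h2 h3; move: (m.+1%:R^-1) (n.+1%:R^-1) (rnorm _) => r1 r2 r3; lra.
have [p fp] := seq_cauchy_cvg cf.
exists p; first by apply: cV fp => n; case: (fP n).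
move=> v Vv; apply/ler_addgt0Pr => e e0.
have e2 : 0 < e / 2 by lra.
have [N hN] := fp _ e2.
have [N' _ hN'] : \forall n \near \oo, n.+1%:R^-1 < (e / 2) ^+ 2 :> R.
  by apply: near_infty_natSinv_lt (PosNum _); rewrite exprn_gt0.
set n := maxn N N'; have [Vn xn] := fP n.
have hn : n.+1%:R^-1 < (e / 2) ^+ 2 :> R by apply: hN'; rewrite /= leq_maxr.
have hn' : rnorm (f n - p) < e / 2 by apply: hN; rewrite leq_maxl.
have -> : x - p = (x - f n) + (f n - p) by rewrite addrA subrK.
apply: (le_trans (rnorm_triangle _ _)).
suff : rnorm (x - f n) <= rnorm (x - v) + e / 2 by lra.
(* After squaring: |x - f n|^2 < d + (e/2)^2 <= |x - v|^2 + (e/2)^2 <= (|x - v| + e/2)^2. *)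
rewrite -(@ler_pXn2r _ 2)// ?nnegrE ?rnorm_ge0//; last first.
  by rewrite addr_ge0 ?rnorm_ge0// ltW.
move: hn xn (dle _ Vv) (rnorm_ge0 (x - v)); rewrite -/n.
move: (n.+1%:R^-1) (rnorm _) (rnorm _) => r1 r2 r3; nra.
Qed.

(** Moving the nearest point along a vector of [V] cannot reduce the distance, so the first
    variation vanishes. Applying this to v and to i v gives complex orthogonality. *)
Lemma orthogonal_projection V (x : H) : subspace V -> seq_closed V ->
  exists2 p, V p & orthocomplement V (x - p).
Proof.
move=> sV cV; have [p Vp pmin] := exists_nearest x sV cV.
exists p => //.
have rip0 v : V v -> rip (x - p) v = 0.
  move=> Vv; have [y yE] : exists y, y = x - p by exists (x - p).
  rewrite -yE.
  have key (t : R) : 2 * t * rip y v <= t ^+ 2 * rnorm v ^+ 2.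
    have Vt : V (p + t%:C *: v) by apply: subspaceD => //; exact: subspaceZ.
    have := pmin _ Vt; rewrite opprD addrA -yE => h.
    have : rnorm y ^+ 2 <= rnorm (y - t%:C *: v) ^+ 2.
      by rewrite lerXn2r// nnegrE rnorm_ge0.
    by rewrite -!ripuu !ripE (ripC v y) !ripuu; lra.
  have [v0|v0] := eqVneq v 0; first by rewrite v0 ripC rip0l.
  have vgt0 : 0 < rnorm v ^+ 2.
    rewrite exprn_gt0// lt_neqAle rnorm_ge0 andbT eq_sym.
    by apply: contra_neq v0; exact: rnorm0_eq0.
  (* With r = <y, v> and q = |v|^2, the choice t = r / q turns [key] into 2 r^2 / q <= r^2 / q,
     forcing r = 0. *)
  have := key (rip y v / rnorm v ^+ 2).
  set r := rip y v; set q := rnorm v ^+ 2.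
  have -> : 2 * (r / q) * r = 2 * (r ^+ 2 / q) by field; rewrite gt_eqF.
  have -> : (r / q) ^+ 2 * q = r ^+ 2 / q by field; rewrite gt_eqF.
  have := sqr_ge0 r => h1 h2.
  have : r ^+ 2 / q <= 0 by have := divr_ge0 h1 (ltW vgt0); lra.
  rewrite pmulr_lle0 ?invr_gt0// => h3.
  by apply/eqP; rewrite -sqrf_eq0; apply/eqP; lra.
move=> v Vv; apply/inner_eq0P; split; first exact: rip0.
by apply: rip0; exact: subspaceZ.
Qed.

Lemma full_of_orthocomplement V : subspace V -> seq_closed V ->
  (forall w, orthocomplement V w -> w = 0) -> forall x, V x.
Proof.
move=> sV cV V0 x; have [p Vp /V0/eqP] := orthogonal_projection x sV cV.
by rewrite subr_eq0 => /eqP->.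
Qed.

Lemma nondegenerate w w' : (forall u, '[u, w] = '[u, w']) -> w = w'.
Proof.
move=> h; apply/eqP; rewrite -subr_eq0; apply/eqP/rnorm0_eq0/eqP.
rewrite -sqrf_eq0 -ripuu.
have /inner_eqP[h1 _] := h (w - w').
by rewrite ripDr ripNr h1 subrr.
Qed.

(** Continuity enters through the closed kernel. A vector z orthogonal to the kernel with f z
    nonzero determines f, because u - (f u / f z) z lies in the kernel. *)
Lemma riesz (f : H -> R[i]) :
  (forall k u v, f (k *: u + v) = k * f u + f v) ->
  seq_closed [set u | f u = 0] ->
  exists w, forall u, f u = '[u, w].
Proof.
move=> flin fcl.
have f0 : f 0 = 0.
  by have := flin (-1) 0 0; rewrite scaler0 addr0 mulN1r addNr.
have sV : subspace [set u | f u = 0].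
  by split => //= k u v fu fv; rewrite flin fu fv mulr0 addr0.
have [ftriv|/existsNP[x fx]] := pselect (forall u, f u = 0).
  by exists 0 => u; rewrite ftriv; apply/esym; exact: linear0r.
have [p /= fp porth] := orthogonal_projection x sV fcl.
set z := x - p in porth.
have fz : f z != 0.
  apply/eqP => fz; apply: fx; have -> : x = 1 *: z + p by rewrite scale1r subrK.
  by rewrite flin fz fp mulr0 addr0.
have z0 : '[z, z] != 0.
  rewrite inner_normE sqrf_eq0 normr_eq0; apply: contra_neq fz => ->; exact: f0.
(* The scalar is conjugated because it leaves the second argument conjugated again. *)
exists (conjc (f z / '[z, z]) *: z) => u.
have : f (- (f u / f z) *: z + u) = 0 by rewrite flin mulNr divfK// addNr.
move=> /porth; rewrite innerC => /(congr1 (@conjc R)); rewrite conjcK conjc0.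
rewrite innerDl innerZl => /eqP; rewrite addrC mulNr subr_eq0 => /eqP huz.
rewrite innerZr conjcK huz.
by field; rewrite fz z0.
Qed.

End Projection.

(* Sokal's proof of the uniform boundedness principle: given f_n in E with
   |f_n| > 2 n 3^n, move from y_n to y_(n+1) by at most 3^-n so that
   |<y_(n+1), f_n>| >= 3^-n |f_n|. The limit of y_n is then within 3^-n / 2 of
   y_(n+1), hence its product with f_n is at least 3^-n |f_n| / 2 > n. *)
Lemma uniform_boundedness (R : realType) (H : hilbertType R) (E : set H) :
  (forall x, exists M : R, forall f, E f -> `|rip x f| <= M) ->
  exists M : R, forall f, E f -> rnorm f <= M.
Proof.
move=> ptw; apply: contrapT => unb.
have gex (n : nat) : exists f, E f /\ 2 * n%:R * 3 ^+ n < rnorm f.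
  apply: contrapT => h; apply: unb; exists (2 * n%:R * 3 ^+ n) => f Ef.
  by rewrite leNgt; apply/negP => hf; apply: h; exists f.
have [g gP] := choice gex.
have stepex (xn : H * nat) : exists x' : H,
    rnorm (x' - xn.1) <= 3^-1 ^+ xn.2 /\
    3^-1 ^+ xn.2 * rnorm (g xn.2) <= `|rip x' (g xn.2)|.
  case: xn => x n /=; move: (g n) => f; set r : R := 3^-1 ^+ n.
  have r0 : 0 <= r by rewrite exprn_ge0.
  have [f0|f0] := eqVneq (rnorm f) 0.
    by exists x; rewrite subrr rnorm0 f0 mulr0.
  pose y := (r / rnorm f)%:C *: f.
  have yn : rnorm y = r.
    by rewrite rnormZ ger0_norm ?divr_ge0 ?rnorm_ge0// divfK.
  have yf : rip y f = r * rnorm f.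
    by rewrite ripZl ripuu expr2 mulrA divfK.
  have rf0 : 0 <= r * rnorm f by rewrite mulr_ge0 ?rnorm_ge0.
  (* The move is taken with the sign of [rip x f], so that the two contributions do not cancel. *)
  have [xf|xf] := lerP 0 (rip x f).
    exists (x + y); rewrite addrC addKr yn; split=> //.
    by rewrite ripDl yf ger0_norm ?lerDr// addr_ge0.
  exists (x - y); rewrite addrC addKr rnormN yn; split=> //.
  by rewrite ripDl ripNl yf ltr0_norm; lra.
have [step stepP] := choice stepex.
pose y := fix y n := if n is m.+1 then step (y m, m) else 0.
have ystep n : rnorm (y n.+1 - y n) <= 3^-1 ^+ n by case: (stepP (y n, n)).
have ylow n : 3^-1 ^+ n * rnorm (g n) <= `|rip (y n.+1) (g n)|.
  by case: (stepP (y n, n)).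
have pow0 n : 0 < 3^-1 ^+ n :> R by rewrite exprn_gt0.
(* The right-hand side is the geometric sum of the k steps starting at n. *)
have ydist n k : rnorm (y (n + k)%N - y n) <= 3^-1 ^+ n * (3 / 2) * (1 - 3^-1 ^+ k).
  elim: k => [|k IHk]; first by rewrite addn0 subrr rnorm0 expr0 subrr mulr0.
  have -> : y (n + k.+1)%N - y n = (y (n + k).+1 - y (n + k)%N) + (y (n + k)%N - y n).
    by rewrite addnS addrA subrK.
  have := rnorm_triangle (y (n + k).+1 - y (n + k)%N) (y (n + k)%N - y n).
  have := ystep (n + k)%N; rewrite exprD exprSr.
  move: IHk; lra.
have ydist' n m : (n <= m)%N -> rnorm (y m - y n) <= 3^-1 ^+ n * (3 / 2).
  move=> nm; rewrite -(subnKC nm); apply: (le_trans (ydist _ _)).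
  by rewrite ler_piMr ?mulr_ge0 ?ltW// lerBlDr lerDl ltW.
have pow_le (n : nat) : 3^-1 ^+ n <= n.+1%:R^-1 :> R.
  rewrite exprVn lef_pV2 ?posrE ?exprn_gt0//.
  by rewrite -natrX ler_nat; exact: ltn_expl.
have small (e : R) : 0 < e -> exists n : nat, 3^-1 ^+ n * (3 / 2) < e.
  move=> e0; have [N _ hN] : \forall n \near \oo, n.+1%:R^-1 < e / 2 :> R.
    by apply: near_infty_natSinv_lt (PosNum _); rewrite divr_gt0.
  exists N; have := pow_le N; have := hN N (leqnn N); move=> /=.
  move: (N.+1%:R^-1) (pow0 N) => r ? ? ?; lra.
have cy : seq_cauchy y.
  move=> e e0; have e2 : 0 < e / 2 by lra.
  have [N hN] := small _ e2; exists N => m n Nm Nn.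
  have -> : y m - y n = (y m - y N) + (y N - y n) by rewrite addrA subrK.
  have := rnorm_triangle (y m - y N) (y N - y n).
  have := ydist' _ _ Nm; have := ydist' _ _ Nn; rewrite (rnorm_distC (y n)); lra.
have [l yl] := seq_cauchy_cvg cy.
have ldist n : rnorm (l - y n) <= 3^-1 ^+ n * (3 / 2).
  apply/ler_addgt0Pr => e e0; have [N hN] := yl _ e0.
  have := hN (maxn n N) (leq_maxr _ _); have := ydist' _ _ (leq_maxl n N).
  have -> : l - y n = (l - y (maxn n N)) + (y (maxn n N) - y n) by rewrite addrA subrK.
  have := rnorm_triangle (l - y (maxn n N)) (y (maxn n N) - y n).
  rewrite (rnorm_distC l); lra.
have [M lM] := ptw l.
have nM (n : nat) : n%:R <= M.
  have [Eg gn] := gP n; apply: le_trans (lM _ Eg).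
  have h1 := ylow n; have h2 := ldist n.+1.
  have h3 : `|rip (l - y n.+1) (g n)| <= 3^-1 ^+ n / 2 * rnorm (g n).
    apply: (le_trans (rip_abs_le _ _)); rewrite ler_wpM2r ?rnorm_ge0//.
    by move: h2; rewrite exprSr; lra.
  have h4 : `|rip (y n.+1) (g n)| <= `|rip l (g n)| + `|rip (l - y n.+1) (g n)|.
    have -> : rip (y n.+1) (g n) = rip l (g n) - rip (l - y n.+1) (g n).
      by rewrite ripDl ripNl; lra.
    exact: ler_normB.
  have : n%:R <= 3^-1 ^+ n / 2 * rnorm (g n).
    apply: (@le_trans _ _ (3^-1 ^+ n / 2 * (2 * n%:R * 3 ^+ n))); last first.
      by rewrite ler_wpM2l ?ltW// divr_gt0.
    rewrite exprVn.
    have p3 : 3 ^+ n != 0 :> R by rewrite expf_neq0// pnatr_eq0.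
    by rewrite le_eqVlt; apply/orP; left; apply/eqP; field.
  move: h1 h3 h4; lra.
have [m Mm] : exists m : nat, M < m%:R.
  by exists (Num.bound `|M|); apply: (le_lt_trans (ler_norm M)); exact: archi_boundP.
by have := nM m; rewrite leNgt Mm.
Qed.

(** * Adjoints of bounded operators, and the lower bound given by a closed range *)

Section Adjoint.
Context (R : realType) (H1 H2 : hilbertType R) (B : {linear H1 -> H2}).
Hypothesis Bcont : continuous B.

(** The functional u |-> <B u, v> has closed kernel because [B] is bounded, so Riesz provides a
    vector for [get] to select. *)
Lemma adjointP u v : '[B u, v] = '[u, adjoint B v].
Proof.
suff [w wP] : exists w : H1, forall u, '[B u, v] = '[u, w].
  have := @getPex _ [set w : H1 | forall u : H1, '[B u, v] = '[u, w]].
  by apply; exists w.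
apply: (riesz (f := fun u => '[B u, v])).
  by move=> k x y; rewrite linearP innerDl innerZl.
have [M M0 BM] := continuous_rnorm_bound Bcont.
move=> x l /= xv xl.
have Bxl : seq_cvg (B \o x) (B l).
  move=> e e0; have eM : 0 < e / M by rewrite divr_gt0.
  have [N hN] := xl _ eM; exists N => n Nn /=.
  by rewrite -linearB (le_lt_trans (BM _))// mulrC -ltr_pdivlMr// hN.
apply/inner_eq0P; split; apply: (rip_const_cvg Bxl) => n.
  by case/inner_eq0P: (xv n).
by case/inner_eq0P: (xv n).
Qed.

Lemma adjoint_rip u v : rip (B u) v = rip u (adjoint B v).
Proof. by rewrite /rip adjointP. Qed.

Lemma adjoint_linear k u v :
  adjoint B (k *: u + v) = k *: adjoint B u + adjoint B v.
Proof.
apply: nondegenerate => w.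
by rewrite -adjointP !innerDr !innerZr -!adjointP.
Qed.

Lemma adjoint_orthocomplement_range v :
  orthocomplement (range B) v -> adjoint B v = 0.
Proof.
move=> vB; apply: nondegenerate => w; rewrite -adjointP innerC vB ?conjc0//.
by apply/esym; exact: linear0r.
Qed.

(** For w = B^* v one has |w|^2 = <B w, v> <= M |w| |v|, and |w| cancels. *)
Lemma adjoint_le (M : R) v : 0 <= M -> (forall u, rnorm (B u) <= M * rnorm u) ->
  rnorm (adjoint B v) <= M * rnorm v.
Proof.
move=> M0 BM; set w := adjoint B v.
have [w0|w0] := eqVneq (rnorm w) 0; first by rewrite w0 mulr_ge0 ?rnorm_ge0.
have wgt0 : 0 < rnorm w by rewrite lt_neqAle eq_sym w0 rnorm_ge0.
rewrite -(ler_pM2r wgt0) -expr2 -ripuu {2}/w -adjoint_rip.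
apply: (le_trans (rip_le _ _)).
by have := BM w; have := rnorm_ge0 v; nra.
Qed.

Lemma range_subspace : subspace (range B).
Proof.
split; first by exists 0; rewrite ?linear0.
by move=> k _ _ [x _ <-] [y _ <-]; exists (k *: x + y); rewrite ?linearP.
Qed.

(* The vectors u of the closed range with |B^* u| <= 1 are weakly bounded,
   since <B y + z, u> = <y, B^* u> for z orthogonal to the range. *)
Lemma adjoint_bounded_below : seq_closed (range B) ->
  exists2 M : R, 0 < M & forall u, range B u -> rnorm u <= M * rnorm (adjoint B u).
Proof.
move=> cB.
have [M EM] : exists M : R, forall f,
    [set u | range B u /\ rnorm (adjoint B u) <= 1] f -> rnorm f <= M.
  apply: uniform_boundedness => x.
  have [_ [y _ <-] xorth] := orthogonal_projection x range_subspace cB.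
  exists (rnorm y) => f [Bf f1].
  have -> : rip x f = rip y (adjoint B f).
    have /inner_eq0P[h _] := xorth _ Bf.
    by rewrite -adjoint_rip -(subrK (B y) x) ripDl h add0r.
  by apply: (le_trans (rip_abs_le _ _)); rewrite ler_piMr ?rnorm_ge0.
have aZ (t : R) u : rnorm (adjoint B (t%:C *: u)) = `|t| * rnorm (adjoint B u).
  have B0 : adjoint B 0 = 0.
    by apply: adjoint_orthocomplement_range => v _; exact: linear0l.
  by have := adjoint_linear t%:C u 0; rewrite B0 !addr0 => ->; rewrite rnormZ.
exists (`|M| + 1); first by rewrite ltr_wpDl.
move=> u Bu; set b := rnorm (adjoint B u).
have M1 : M <= `|M| + 1 by have := ler_norm M; lra.
have rZ (t : R) : range B (t%:C *: u) by exact: subspaceZ range_subspace Bu.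
(* If B^* u = 0, all multiples of [u] lie in the bounded set; for nonzero [u], the one of norm |M| +
   1 contradicts the bound [M]. Otherwise u / b lies in the set. *)
have [b0|b0] := eqVneq b 0.
  rewrite b0 mulr0 leNgt; apply/negP => u0.
  have := EM (((`|M| + 1) / rnorm u)%:C *: u).
  rewrite rnormZ (@ger0_norm _ (_ / _)); last first.
    by rewrite divr_ge0 ?rnorm_ge0// addr_ge0.
  rewrite divfK ?gt_eqF//.
  have h : [set u | range B u /\ rnorm (adjoint B u) <= 1]
      (((`|M| + 1) / rnorm u)%:C *: u).
    by split => //; rewrite aZ -/b b0 mulr0.
  by move=> /(_ h); have := ler_norm M; lra.
have bgt0 : 0 < b by rewrite lt_neqAle eq_sym b0 rnorm_ge0.
have bV : `|b^-1| = b^-1 by rewrite ger0_norm// invr_ge0 ltW.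
have : rnorm (b^-1%:C *: u) <= M.
  by apply: EM; split => //; rewrite aZ -/b bV mulVf.
rewrite rnormZ bV mulrC ler_pdivrMr// => h.
by apply: (le_trans h); rewrite ler_wpM2r// ltW.
Qed.

End Adjoint.

(** * Self-adjoint operators: symmetric perturbation, closedness, coercive inversion *)

Section SelfAdjoint.
Context (R : realType) (H : hilbertType R).
Implicit Types (T : operator H).

(** As [K] is symmetric and defined everywhere, (w, z) is in the adjoint graph of T + K exactly when
    (w, z - K w) is in that of T. *)
Lemma self_adjoint_perturbation T (K : H -> H) :
  self_adjoint T ->
  (forall k u v, K (k *: u + v) = k *: K u + K v) ->
  (forall u v, '[K u, v] = '[u, K v]) ->
  self_adjoint (Operator (op_dom T) (fun u => op_fun T u + K u)).
Proof.
move=> [[T0 Tlin Tfun] Tdense Tadj] Klin Ksym.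
split => //.
  split => //= k u v Tu Tv.
  by rewrite Tfun// Klin scalerDr addrACA.
apply/seteqP; split => -[w z] /=.
  move=> wz; have : adjoint_graph T (w, z - K w).
    move=> u Tu /=; have := wz _ Tu => /= h.
    by rewrite innerBr -h innerDl Ksym addrK.
  rewrite Tadj => -[/= Tw zE]; split => //=.
  by rewrite -zE subrK.
move=> [/= Tw zE] u Tu /=.
have : adjoint_graph T (w, op_fun T w) by rewrite Tadj.
by move=> /(_ u Tu)/= h; rewrite innerDl h Ksym -innerDr zE.
Qed.

(** The adjoint graph is cut out by equations that pass to limits, and here it equals the graph of
    [T]. *)
Lemma self_adjoint_seq_closed T (x : nat -> H) u v :
  self_adjoint T -> (forall n, op_dom T (x n)) ->
  seq_cvg x u -> seq_cvg (fun n => op_fun T (x n)) v ->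
  op_dom T u /\ op_fun T u = v.
Proof.
move=> [_ _ Tadj] Tx xu Txv.
suff : adjoint_graph T (u, v) by rewrite Tadj => -[/= Tu ->].
move=> w Tw /=.
have sym n : '[op_fun T w, x n] = '[w, op_fun T (x n)].
  have : adjoint_graph T (x n, op_fun T (x n)) by rewrite Tadj; split => //=.
  by move=> /(_ w Tw).
have wu (w1 w2 : H) : (forall n, rip w1 (x n) = rip w2 (op_fun T (x n))) ->
    rip w1 u = rip w2 v.
  move=> h; apply/eqP; rewrite -subr_eq0 -normr_le0; apply/ler_addgt0Pr => e e0.
  (* Errors e / r in both sequences contribute at most (|w1| + |w2|) e / r, which is below e. *)
  pose r := rnorm w1 + rnorm w2 + 1.
  have r0 : 0 < r by rewrite ltr_wpDl// addr_ge0 ?rnorm_ge0.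
  have er : 0 < e / r by rewrite divr_gt0.
  have [N1 h1] := xu _ er; have [N2 h2] := Txv _ er.
  set n := maxn N1 N2.
  have := h1 n (leq_maxl _ _); have := h2 n (leq_maxr _ _).
  have -> : rip w1 u - rip w2 v = rip w2 (op_fun T (x n) - v) - rip w1 (x n - u).
    by rewrite !ripDr !ripNr h; lra.
  move=> g2 g1; apply: (le_trans (ler_normB _ _)).
  have a1 := rip_abs_le w1 (x n - u); have a2 := rip_abs_le w2 (op_fun T (x n) - v).
  have b1 : rnorm w1 * rnorm (x n - u) <= rnorm w1 * (e / r).
    by rewrite ler_wpM2l ?rnorm_ge0// ltW.
  have b2 : rnorm w2 * rnorm (op_fun T (x n) - v) <= rnorm w2 * (e / r).
    by rewrite ler_wpM2l ?rnorm_ge0// ltW.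
  have : e = rnorm w1 * (e / r) + rnorm w2 * (e / r) + e / r.
    by rewrite /r; field; rewrite gt_eqF.
  lra.
rewrite innerC [RHS]innerC; congr conjc.
apply/inner_eqP; split; rewrite ripC [RHS]ripC; last first.
  apply: wu => n; have := sym n; rewrite innerC [RHS]innerC => /(congr1 (@conjc R)).
  by rewrite !conjcK => /inner_eqP[_]; rewrite ripC => ->; rewrite ripC.
by apply: wu => n; rewrite /rip sym.
Qed.

(** Cauchy-Schwarz gives d |u| <= |T u|, which yields injectivity, closed range and the bound 1/d
    for the inverse. A vector w orthogonal to the range has (w, 0) in the adjoint graph, so T w = 0
    and w = 0. *)
Lemma self_adjoint_coercive_invertible T (d : R) :
  self_adjoint T -> 0 < d ->
  (forall u, op_dom T u -> d * rnorm u ^+ 2 <= rip (op_fun T u) u) ->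
  resolvent_set T 0.
Proof.
move=> Tsa d0 Td; have [[T0 Tlin Tfun] _ Tadj] := Tsa.
have Tlow u : op_dom T u -> d * rnorm u <= rnorm (op_fun T u).
  move=> Tu; have := le_trans (Td _ Tu) (rip_le _ _).
  have [u0|u0] := eqVneq (rnorm u) 0; first by rewrite u0 !mulr0 rnorm_ge0.
  by rewrite expr2 mulrA ler_pM2r// lt_neqAle eq_sym u0 rnorm_ge0.
have TB u v : op_dom T u -> op_dom T v ->
    op_dom T (u - v) /\ op_fun T (u - v) = op_fun T u - op_fun T v.
  move=> Tu Tv; have -> : u - v = (-1) *: v + u by rewrite scaleN1r addrC.
  by split; [exact: Tlin|rewrite Tfun// scaleN1r addrC].
have T0fun : op_fun T 0 = 0.
  by have [_] := TB _ _ T0 T0; rewrite !subrr.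
pose V : set H := [set v | exists2 u, op_dom T u & op_fun T u = v].
have sV : subspace V.
  split; first by exists 0.
  by move=> k _ _ [u Tu <-] [v Tv <-]; exists (k *: u + v); [exact: Tlin|exact: Tfun].
have cV : seq_closed V.
  move=> y l Vy yl.
  (* The [let:] repackages each [exists2] as a plain existential, so that [choice] yields preimages
     [x n] of [y n]. *)
  have [x xP] := choice (fun n => let: ex_intro2 u Tu Tuy := Vy n in
    ex_intro (fun u => op_dom T u /\ op_fun T u = y n) u (conj Tu Tuy)).
  have cx : seq_cauchy x.
    move=> e e0; have de : 0 < d * e by rewrite mulr_gt0.
    have [N hN] := seq_cvg_cauchy yl de; exists N => m n Nm Nn.
    have [Tm ym] := xP m; have [Tn yn] := xP n.
    have [Tmn Emn] := TB _ _ Tm Tn.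
    rewrite -(ltr_pM2l d0); apply: (le_lt_trans (Tlow _ Tmn)).
    by rewrite Emn ym yn hN.
  have [u xu] := seq_cauchy_cvg cx.
  have [||Tu Tul] := @self_adjoint_seq_closed T x u l Tsa _ xu.
  - by move=> n; case: (xP n).
  - by have -> : (fun n => op_fun T (x n)) = y by apply/funext => n; case: (xP n).
  by exists u.
have V0 w : orthocomplement V w -> w = 0.
  move=> Vw; have : adjoint_graph T (w, 0).
    move=> u Tu /=; rewrite innerC Vw; last by exists u.
    by rewrite conjc0; apply/esym; exact: linear0r.
  rewrite Tadj => -[/= Tw Tw0]; apply: rnorm0_eq0; apply/eqP.
  have := Tlow _ Tw; rewrite -Tw0 rnorm0 pmulr_rle0// => h.
  by rewrite eq_le h rnorm_ge0.
have [J JP] := choice (fun v => let: ex_intro2 u Tu Tuv := full_of_orthocomplement sV cV V0 v in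
    ex_intro (fun u => op_dom T u /\ op_fun T u = v) u (conj Tu Tuv)).
have Tinj u v : op_dom T u -> op_dom T v -> op_fun T u = op_fun T v -> u = v.
  move=> Tu Tv uv; have [Tuv Euv] := TB _ _ Tu Tv.
  have := Tlow _ Tuv; rewrite Euv uv subrr rnorm0 pmulr_rle0// => h.
  by apply/eqP; rewrite -subr_eq0; apply/eqP/rnorm0_eq0/eqP; rewrite eq_le h rnorm_ge0.
have Jlin : linear J.
  move=> k u v; have [Tu Eu] := JP u; have [Tv Ev] := JP v; have [Tw Ew] := JP (k *: u + v).
  by apply: Tinj => //; [exact: Tlin|rewrite Ew Tfun// Eu Ev].
pose Jl : {linear H -> H} := HB.pack J (GRing.isLinear.Build _ _ _ _ J Jlin).
exists Jl; split.
- apply: (@rnorm_bound_continuous _ _ _ Jl d^-1) => v /=.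
  have [Tv Ev] := JP v; rewrite -(ler_pM2l d0) mulrA mulfV ?gt_eqF// mul1r.
  by rewrite -{2}Ev Tlow.
- by move=> v /=; have [Tv Ev] := JP v; rewrite Ev scale0r subr0.
- move=> u /= Tu; rewrite scale0r subr0.
  by have [Tv Ev] := JP (op_fun T u); apply: Tinj.
Qed.

End SelfAdjoint.

(** * Monotonicity, poles and zeros of the scalar functions *)

Lemma divr_sub_lt (R : realType) (h p x y : R) :
  0 < h -> x < y -> 0 < (p - x) * (p - y) -> h / (p - x) < h / (p - y).
Proof.
move=> h0 xy pxy; rewrite -subr_gt0.
have px : p - x != 0 by apply: contraTneq pxy => ->; rewrite mul0r ltxx.
have py : p - y != 0 by apply: contraTneq pxy => ->; rewrite mulr0 ltxx.
have -> : h / (p - y) - h / (p - x) = h * (y - x) / ((p - x) * (p - y)).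
  by field; rewrite px py.
by rewrite divr_gt0// mulr_gt0// subr_gt0.
Qed.

(** Intermediate values give existence and strict monotonicity the rest. Asking only for order
    convexity of [I] covers the bounded gaps and the unbounded last one; the sign left of the zero
    feeds the coercivity estimates. *)
Lemma unique_zero_increasing (R : realType) (I : set R) (f : R -> R) (p q : R) :
  (forall x y z, I x -> I z -> x <= y <= z -> I y) ->
  (forall x, I x -> {for x, continuous f}) ->
  (forall x y, I x -> I y -> x < y -> f x < f y) ->
  I p -> I q -> f p < 0 -> 0 < f q ->
  exists2 e, unique_zero_in I f e & forall x, I x -> x < e -> f x < 0.
Proof.
move=> Iconv fcont finc Ip Iq fp fq.
have pq : p < q.
  rewrite ltNge le_eqVlt; apply/negP => /orP[/eqP qp|qp].
    by move: fq; rewrite qp => /(lt_trans fp); rewrite ltxx.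
  by have := finc _ _ Iq Ip qp; lra.
have [||e epq fe] := @IVT R f p q 0 (ltW pq).
- apply: continuous_in_subspaceT => x; rewrite inE /= in_itv/= => /(Iconv _ _ _ Ip Iq).
  exact: fcont.
- by rewrite ge_min le_max (ltW fp) (ltW fq) orbT.
have Ie : I e by apply: (Iconv p e q) => //; move: epq; rewrite in_itv.
exists e; last by move=> x Ix xe; rewrite -fe; exact: finc.
split=> // y Iy fy; apply/eqP; rewrite eq_le !leNgt; apply/andP; split; apply/negP => h.
- by have := finc _ _ Ie Iy h; rewrite fe fy ltxx.
- by have := finc _ _ Iy Ie h; rewrite fe fy ltxx.
Qed.

Section Psi.
Context (R : realType) (L : nat) (c gm gp : 'I_L -> R) (l : 'I_L).
Hypothesis c_incr : forall i j : 'I_L, (i < j)%N -> c i < c j.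
Hypothesis gm_gt0 : forall k, 0 < gm k.
Hypothesis gp_gt0 : forall k, 0 < gp k.

Definition psi_coef (k : 'I_L) : R := if (k <= l)%N then gm k else gp k.

Lemma psi_coef_gt0 k : 0 < psi_coef k.
Proof. by rewrite /psi_coef; case: ifP. Qed.

Lemma psiE x : psi c gm gp l x = \sum_k psi_coef k / (c k - x).
Proof.
rewrite /psi [RHS](bigID (fun k : 'I_L => (k <= l)%N)) /=; congr (_ + _).
  by apply: eq_bigr => k kl; rewrite /psi_coef kl.
by apply: eq_big => k => [|lk]; rewrite ?ltnNge // /psi_coef leqNgt lk.
Qed.

Lemma gap_lt (k : 'I_L) x : gap c l x -> (k <= l)%N -> c k < x.
Proof.
move=> /andP[]; rewrite lte_fin => lx _; rewrite leq_eqVlt => /orP[/eqP/val_inj->//|kl].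
exact: lt_trans (c_incr kl) lx.
Qed.

Lemma gap_gt (k : 'I_L) x : gap c l x -> (l < k)%N -> x < c k.
Proof.
move=> /andP[_]; rewrite /next_c; case: insubP => [j _ jl|nl _ lk].
  rewrite lte_fin => xj; rewrite -jl leq_eqVlt => /orP[/eqP/val_inj<-//|jk].
  exact: lt_trans (c_incr jk).
(* Here l + 1 is not an index, so the gap is unbounded and no k > l exists. *)
by have := leq_ltn_trans lk (ltn_ord k); rewrite (negPf nl).
Qed.

Lemma gap_convex x y z : gap c l x -> gap c l z -> x <= y <= z -> gap c l y.
Proof.
move=> /andP[lx _] /andP[_ zn] /andP[xy yz]; apply/andP; split.
  by apply: (lt_le_trans lx); rewrite lee_fin.
by apply: le_lt_trans zn; rewrite lee_fin.
Qed.

(** No pole lies inside the gap, so [x] and [y] are on the same side of [c k]. With x = y this also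
    gives that [c k - x] is nonzero. *)
Lemma gap_prod_gt0 k x y : gap c l x -> gap c l y -> 0 < (c k - x) * (c k - y).
Proof.
move=> gx gy; have [kl|lk] := leqP k l.
  by rewrite nmulr_rgt0 subr_lt0; exact: gap_lt.
by rewrite mulr_gt0// subr_gt0; exact: gap_gt.
Qed.

Lemma psi_term_lt k x y : gap c l x -> gap c l y -> x < y ->
  psi_coef k / (c k - x) < psi_coef k / (c k - y).
Proof.
move=> gx gy xy; apply: divr_sub_lt => //; first exact: psi_coef_gt0.
exact: gap_prod_gt0.
Qed.

(** Once the pole at [c j] is isolated, the remaining terms are controlled by their values at a
    fixed point of the gap. *)
Lemma psi_rest_le j x y : gap c l x -> gap c l y -> x <= y ->
  \sum_(k | k != j) psi_coef k / (c k - x) <=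
  \sum_(k | k != j) psi_coef k / (c k - y).
Proof.
move=> gx gy; rewrite le_eqVlt => /orP[/eqP->//|xy].
by apply: ler_sum => k _; apply: ltW; exact: psi_term_lt.
Qed.

Lemma psi_lt x y : gap c l x -> gap c l y -> x < y ->
  psi c gm gp l x < psi c gm gp l y.
Proof.
move=> gx gy xy; rewrite !psiE (bigD1 l)// [ltRHS](bigD1 l)//=.
by rewrite ltr_leD ?psi_term_lt// psi_rest_le// ltW.
Qed.

Lemma psi_continuous x : gap c l x -> {for x, continuous (psi c gm gp l)}.
Proof.
move=> gx; rewrite (_ : psi c gm gp l = fun x => \sum_k psi_coef k / (c k - x)); last first.
  by apply/funext => y; rewrite psiE.
apply: cvg_big => [|k _]; first exact: add_continuous.
apply: cvgMr; apply: cvgV.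
  by apply: contraTneq (gap_prod_gt0 k gx gx) => ->; rewrite mul0r ltxx.
by apply: cvgB; [exact: cvg_cst|exact: cvg_id].
Qed.

Lemma gap_nonempty : exists m, gap c l m.
Proof.
rewrite /gap /next_c; case: insubP => [j _ jl|nl].
  exists ((c l + c j) / 2); rewrite /= !lte_fin.
  by have := @c_incr l j; rewrite jl ltnSn => /(_ isT) h; apply/andP; split; lra.
by exists (c l + 1); rewrite /= lte_fin ltry andbT ltrDl.
Qed.

Lemma gap_left x m : gap c l m -> c l < x -> x <= m -> gap c l x.
Proof.
move=> /andP[_ mn] lx xm; apply/andP; split; first by rewrite lte_fin.
by apply: le_lt_trans mn; rewrite lee_fin.
Qed.

(* The pole at c l dominates the other terms near the left end of the gap. *)
Lemma psi_small (C m : R) : gap c l m ->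
  exists x, [/\ gap c l x, x <= m & psi c gm gp l x < C].
Proof.
move=> gapm; set D := \sum_(k | k != l) psi_coef k / (c k - m).
have lm := gap_lt gapm (leqnn l).
have g0 := psi_coef_gt0 l; set g := psi_coef l in g0 *.
pose E := `|C - D| + 1; have E0 : 0 < E by rewrite ltr_wpDl.
(* The first entry keeps [c l + d] at or left of [m]; the second makes the polar term at most -E,
   and D - E < C. *)
pose d := Num.min (m - c l) (g / E).
have d0 : 0 < d by rewrite lt_min subr_gt0 lm divr_gt0.
have dm : d <= m - c l by rewrite ge_min lexx.
have dg : d <= g / E by rewrite ge_min lexx orbT.
have gx : gap c l (c l + d) by apply: (gap_left gapm); lra.
exists (c l + d); split => //; first by lra.
rewrite psiE (bigD1 l)//= -/g.
have := psi_rest_le l gx gapm; rewrite -/D => /(_ ltac:(lra)).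
have -> : g / (c l - (c l + d)) = - (g / d).
  by rewrite opprD addrA subrr add0r invrN mulrN.
have : E <= g / d by rewrite ler_pdivlMr// mulrC -ler_pdivlMr.
rewrite /E; have := ler_norm (D - C); rewrite distrC; lra.
Qed.

(** Mirror image at the right end: the pole at [c j] tends to +oo from the left, while the other
    terms stay above their values at [m]. *)
Lemma psi_large (C m : R) (j : 'I_L) : gap c l m -> val j = l.+1 ->
  exists x, [/\ gap c l x, m <= x & C < psi c gm gp l x].
Proof.
move=> gapm jl; set D := \sum_(k | k != j) psi_coef k / (c k - m).
have lj : (l < j)%N by rewrite [X in (_ < X)%N]jl.
have mj := gap_gt gapm lj; have lm := gap_lt gapm (leqnn l).
have g0 := psi_coef_gt0 j; set g := psi_coef j in g0 *.
pose E := `|C - D| + 1; have E0 : 0 < E by rewrite ltr_wpDl.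
pose d := Num.min (c j - m) (g / E).
have d0 : 0 < d by rewrite lt_min subr_gt0 mj divr_gt0.
have dm : d <= c j - m by rewrite ge_min lexx.
have dg : d <= g / E by rewrite ge_min lexx orbT.
have gx : gap c l (c j - d).
  rewrite /gap /next_c /=; case: insubP => [i _ il|]; last by rewrite -jl ltn_ord.
  have -> : i = j by apply: val_inj; rewrite il jl.
  by rewrite !lte_fin; apply/andP; split; lra.
exists (c j - d); split => //; first by lra.
rewrite psiE (bigD1 j)//= -/g.
have := psi_rest_le j gapm gx; rewrite -/D => /(_ ltac:(lra)).
have -> : c j - (c j - d) = d by ring.
have : E <= g / d by rewrite ler_pdivlMr// mulrC -ler_pdivlMr.
rewrite /E; have := ler_norm (C - D); lra.
Qed.

(** The hypothesis makes [next_c] finite, so the gap has a pole at each end and [psi] takes both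
    signs. *)
Lemma psi_unique_zero (a : R) : (next_c c l < a%:E)%E ->
  exists2 e, unique_zero_in (gap c l) (psi c gm gp l) e &
    forall x, gap c l x -> x < e -> psi c gm gp l x < 0.
Proof.
rewrite /next_c; case: insubP => [j _ jl _|//].
have [m gapm] := gap_nonempty.
have [p [gapp _ p0]] := psi_small 0 gapm; have [q [gapq _ q0]] := psi_large 0 gapm jl.
exact: (unique_zero_increasing gap_convex psi_continuous psi_lt gapp gapq).
Qed.

(** The negated function [f] is increasing. In the last gap, which has no right pole, the term x - a
    makes it positive. *)
Lemma affine_sub_psi_unique_zero (a : R) :
  exists2 e, unique_zero_in (gap c l) (fun x => a - x - psi c gm gp l x) e &
    forall x, gap c l x -> x < e -> 0 < a - x - psi c gm gp l x.
Proof.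
pose f x := psi c gm gp l x + (x - a).
have fE x : a - x - psi c gm gp l x = - f x by rewrite /f; ring.
have [m gapm] := gap_nonempty.
(* Since p <= m, a value of [psi] below a - m is also below a - p, whence f p < 0. *)
have [p [gapp pm p0]] := psi_small (a - m) gapm.
have fp : f p < 0 by rewrite /f; lra.
have [q gapq fq] : exists2 q, gap c l q & 0 < f q.
  case: (insubP 'I_L l.+1) => [j _ jl|nl].
    have [q [gapq mq q0]] := psi_large (a - m) gapm jl.
    by exists q => //; rewrite /f; lra.
  (* As [psi] increases, f q > f m + (q - m) = f m + |f m| + 1 > 0. *)
  pose q := m + `|psi c gm gp l m + (m - a)| + 1.
  have mq : m < q by rewrite /q; have := normr_ge0 (psi c gm gp l m + (m - a)); lra.
  have gapq : gap c l q.
    rewrite /gap /next_c /= insubN// ltry andbT lte_fin.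
    exact: lt_trans (gap_lt gapm (leqnn l)) mq.
  exists q => //; have := psi_lt gapm gapq mq; rewrite /f /q.
  have := ler_norm (- (psi c gm gp l m + (m - a))); rewrite normrN; lra.
have fcont x : gap c l x -> {for x, continuous f}.
  move=> gx; apply: cvgD; first exact: psi_continuous.
  by apply: cvgB; [exact: cvg_id|exact: cvg_cst].
have finc x y : gap c l x -> gap c l y -> x < y -> f x < f y.
  by move=> gx gy xy; rewrite /f; have := psi_lt gx gy xy; lra.
have [e [ge fe0 eu] el] := unique_zero_increasing gap_convex fcont finc gapp gapq fp fq.
exists e; last by move=> x gx xe; rewrite fE oppr_gt0 el.
split => //; first by rewrite fE fe0 oppr0.
by move=> y gy /eqP; rewrite fE oppr_eq0 => /eqP; exact: eu.
Qed.

End Psi.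

(** * S(x) at real x: self-adjointness and its quadratic form *)

Section OperatorS.
Context (R : realType) (L : nat).
Context (H : hilbertType R) (Hh : 'I_L -> hilbertType R).
Context (A : operator H) (B : forall l, {linear Hh l -> H}) (c : 'I_L -> R).
Hypothesis Asa : self_adjoint A.
Hypothesis Bcont : forall l, continuous (B l).

(** S(x) = A + K x; for real x the coefficients are real, so [K x] is symmetric because each B B^*
    is. *)
Let K (x : R) (u : H) : H := - (x%:C *: u) -
  \sum_(l < L) ((c l)%:C - x%:C)^-1 *: B l (adjoint (B l) u).

Let sub_realE l (x : R) : ((c l)%:C - x%:C)^-1 = ((c l - x)^-1)%:C.
Proof. by rewrite -rmorphB -fmorphV. Qed.

Let K_linear x k u v : K x (k *: u + v) = k *: K x u + K x v.
Proof.
rewrite /K (eq_bigr (fun l => k *: (((c l)%:C - x%:C)^-1 *: B l (adjoint (B l) u)) +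
   ((c l)%:C - x%:C)^-1 *: B l (adjoint (B l) v))); last first.
  move=> l _; rewrite (adjoint_linear (@Bcont l)) linearP scalerDr; congr (_ + _).
  by rewrite !scalerA mulrC.
rewrite big_split/= -scaler_sumr scalerDr opprD scalerBr scalerN !scalerA (mulrC k).
by rewrite opprD addrACA.
Qed.

Let inner_suml (I : finType) (F : I -> H) v : '[\sum_i F i, v] = \sum_i '[F i, v].
Proof. exact: linear_sumlz. Qed.
Let inner_sumr (I : finType) (F : I -> H) v : '[v, \sum_i F i] = \sum_i '[v, F i].
Proof. exact: linear_sumr. Qed.

Let K_symmetric x u v : '[K x u, v] = '[u, K x v].
Proof.
have symB l : '[B l (adjoint (B l) u), v] = '[u, B l (adjoint (B l) v)].
  by rewrite (adjointP (@Bcont l)) innerC -(adjointP (@Bcont l)) -innerC.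
have symZ (r : R) w w' : '[w, v] = '[u, w'] -> '[r%:C *: w, v] = '[u, r%:C *: w'].
  by move=> h; rewrite innerZl innerZr conjc_real h.
rewrite /K innerDl innerDr !innerNl !innerNr inner_suml inner_sumr.
congr (- _ - _); first exact: symZ.
by apply: eq_bigr => l _; rewrite sub_realE; exact: symZ.
Qed.

Lemma opS_self_adjoint (x : R) : self_adjoint (opS A B c x%:C).
Proof.
have -> : opS A B c x%:C = Operator (op_dom A) (fun u => op_fun A u + K x u).
  by congr Operator; apply/funext => u; rewrite /K addrA.
exact: self_adjoint_perturbation.
Qed.

Lemma opS_form (x : R) u : rip (op_fun (opS A B c x%:C) u) u =
  rip (op_fun A u) u - x * rnorm u ^+ 2 -
  \sum_(l < L) rnorm (adjoint (B l) u) ^+ 2 / (c l - x).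
Proof.
rewrite /= !ripDl !ripNl ripZl ripuu; congr (_ - _).
transitivity (\sum_(l < L) rip (((c l)%:C - x%:C)^-1 *: B l (adjoint (B l) u)) u).
  by elim/big_rec2: _ => [|l r s _ <-]; rewrite ?rip0l ?ripDl.
apply: eq_bigr => l _.
by rewrite sub_realE ripZl (adjoint_rip (@Bcont l)) ripuu mulrC.
Qed.

Lemma opS_coercive_resolvent (d x : R) : (forall l, c l != x) -> 0 < d ->
  (forall u, op_dom A u -> d * rnorm u ^+ 2 <=
    rip (op_fun A u) u - x * rnorm u ^+ 2 -
    \sum_(l < L) rnorm (adjoint (B l) u) ^+ 2 / (c l - x)) ->
  opS_resolvent_set A B c x%:C.
Proof.
move=> cx d0 Ad; split; first by move=> l; apply: contra_neq (cx l) => /(@complexI R)->.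
apply: (self_adjoint_coercive_invertible (opS_self_adjoint x) d0) => u Au.
by rewrite opS_form; exact: Ad.
Qed.

End OperatorS.

(** * The constants gamma and the estimate of the sum by [psi] *)

Section GammaBounds.
Context (R : realType) (L : nat).
Context (H : hilbertType R) (Hh : 'I_L -> hilbertType R).
Context (B : forall l, {linear Hh l -> H}) (H0 : set H).
Hypothesis Bcont : forall l, continuous (B l).
Hypothesis Bran : forall l, range (B l) = H0.
Hypothesis H0closed : closed H0.

Lemma adjoint_add_orthocomplement l u0 u0' : orthocomplement H0 u0' ->
  adjoint (B l) (u0 + u0') = adjoint (B l) u0.
Proof.
move=> h; have := adjoint_linear (@Bcont l) 1 u0 u0'; rewrite !scale1r => ->.
have h' : orthocomplement (range (B l)) u0' by rewrite Bran.
by rewrite (adjoint_orthocomplement_range (@Bcont l) h') addr0.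
Qed.

Lemma gamma_bounds_rnormP gm gp : gamma_bounds B H0 gm gp <->
  (forall l, 0 < gm l /\ 0 < gp l) /\
  (forall l u0 u0', H0 u0 -> orthocomplement H0 u0' ->
    gm l * rnorm u0 ^+ 2 <= rnorm (adjoint (B l) (u0 + u0')) ^+ 2
      <= gp l * rnorm u0 ^+ 2).
Proof.
by split=> -[h g]; split=> // l u0 u0' hu hu'; have := g l u0 u0' hu hu';
  rewrite !rnormE -!rmorphXn -!rmorphM/= !lecR.
Qed.

Lemma gamma_bounds_exist : exists gm gp, gamma_bounds B H0 gm gp.
Proof.
have ex l : exists g : R * R, (0 < g.1 /\ 0 < g.2) /\ forall u0, H0 u0 ->
    g.1 * rnorm u0 ^+ 2 <= rnorm (adjoint (B l) u0) ^+ 2 <= g.2 * rnorm u0 ^+ 2.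
  have [P P0 BP] := continuous_rnorm_bound (@Bcont l).
  have cB : seq_closed (range (B l)) by rewrite Bran; exact: closed_seq_closed.
  have [M M0 BM] := adjoint_bounded_below (@Bcont l) cB.
  (* These are the squared forms of |u0| <= M |B^* u0| on [H0] and |B^* u0| <= P |u0|. *)
  exists ((M ^+ 2)^-1, P ^+ 2) => /=; split; first by rewrite invr_gt0 !exprn_gt0.
  move=> u0 Hu0; apply/andP; split.
    rewrite mulrC ler_pdivrMr ?exprn_gt0// mulrC -exprMn.
    by rewrite lerXn2r ?nnegrE ?mulr_ge0 ?rnorm_ge0 ?(ltW M0)// BM// Bran.
  rewrite -exprMn lerXn2r ?nnegrE ?mulr_ge0 ?rnorm_ge0 ?(ltW P0)//.
  exact: (adjoint_le (@Bcont l) _ (ltW P0) BP).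
have [g gP] := choice ex.
exists (fun l => (g l).1), (fun l => (g l).2); apply/gamma_bounds_rnormP; split.
  by move=> l; case: (gP l).
move=> l u0 u0' Hu0 Hu0'; rewrite adjoint_add_orthocomplement//.
by case: (gP l) => _; exact.
Qed.

Lemma H0_decomposition (u : H) : (0 < L)%N ->
  exists u0 u0', [/\ H0 u0, orthocomplement H0 u0' & u = u0 + u0'].
Proof.
move=> L0; have sH0 : subspace H0.
  (* [H0] is a subspace as the range of one of the [B l]; positivity of [L] supplies an index. *)
  by rewrite -(Bran (Ordinal L0)); exact: range_subspace.
have [p Hp up] := orthogonal_projection u sH0 (closed_seq_closed H0closed).
by exists p, (u - p); split=> //; rewrite addrC subrK.
Qed.

(** Termwise: dividing by the negative [c k - x] for k <= l calls for the lower bound [gm], dividing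
    by the positive one for k > l for the upper bound [gp]. This is the choice made in [psi]. *)
Lemma sum_adjoint_le (c : 'I_L -> R) gm gp (l : 'I_L) x u0 u0' :
  (forall i j : 'I_L, (i < j)%N -> c i < c j) ->
  gamma_bounds B H0 gm gp -> gap c l x ->
  H0 u0 -> orthocomplement H0 u0' ->
  \sum_k rnorm (adjoint (B k) (u0 + u0')) ^+ 2 / (c k - x) <=
    psi c gm gp l x * rnorm u0 ^+ 2.
Proof.
move=> c_incr /gamma_bounds_rnormP[_ g] gx hu hu'.
rewrite psiE mulr_suml; apply: ler_sum => k _.
have /andP[g1 g2] := g k _ _ hu hu'; rewrite [leRHS]mulrAC /psi_coef.
have [kl|lk] := leqP k l.
  by apply: ler_wnM2r => //; rewrite invr_le0 subr_le0 ltW// (gap_lt c_incr gx).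
by rewrite ler_wpM2r// invr_ge0 subr_ge0 ltW// (gap_gt c_incr gx).
Qed.

End GammaBounds.

Theorem proposition4p8 (R : realType) (L : nat)
  (H : hilbertType R) (Hh : 'I_L -> hilbertType R)
  (A : operator H) (a : R)
  (B : forall l : 'I_L, {linear Hh l -> H}) (H0 : set H) (c : 'I_L -> R)
  (L_gt0 : (0 < L)%N)
  (sepH : separable H) (sepHh : forall l, separable (Hh l))
  (Asa : self_adjoint A) (Acr : compact_resolvent A)
  (Age : bounded_below_by A a)
  (Bcont : forall l, continuous (B l))
  (Bran : forall l, range (B l) = H0) (H0closed : closed H0)
  (c_incr : forall i j : 'I_L, (i < j)%N -> c i < c j) :
  (exists gm gp : 'I_L -> R, gamma_bounds B H0 gm gp) /\
  (forall gm gp : 'I_L -> R, gamma_bounds B H0 gm gp ->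
   forall l : 'I_L,
     ((next_c c l < a%:E)%E ->
       exists eta : R, unique_zero_in (gap c l) (psi c gm gp l) eta /\
         forall lam : R, c l < lam < eta ->
           opS_resolvent_set A B c lam%:C) /\
     (H0 = [set: H] ->
       exists eta' : R,
         unique_zero_in (gap c l)
           (fun lam => a - lam - psi c gm gp l lam) eta' /\
         forall lam : R, c l < lam < eta' ->
           opS_resolvent_set A B c lam%:C)).
Proof.
split; first exact: gamma_bounds_exist.
move=> gm gp gamma l.
have gm0 k : 0 < gm k by case: gamma => /(_ k)[].
have gp0 k : 0 < gp k by case: gamma => /(_ k)[].
have Aform u : op_dom A u -> a * rnorm u ^+ 2 <= rip (op_fun A u) u.
  (* [lecE] splits the order of R[i] into equal imaginary parts and a real inequality; the latter is
     kept. *)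
  by move=> /Age; rewrite rnormE -rmorphXn -rmorphM lecE => /andP[_].
have gap_neq x : gap c l x -> forall k, c k != x.
  move=> gx k; rewrite -subr_eq0; apply: contraTneq (gap_prod_gt0 c_incr k gx gx) => ->.
  by rewrite mul0r ltxx.
have gap_between e x : gap c l e -> c l < x < e -> gap c l x.
  by move=> ge /andP[lx xe]; apply: (gap_left ge) => //; exact: ltW.
split.
- move=> la; have [e [ge fe eu] el] := psi_unique_zero c_incr gm0 gp0 la.
  exists e; split=> // x lxe; have gx := gap_between _ _ ge lxe.
  have psix : psi c gm gp l x < 0 by apply: el => //; case/andP: lxe.
  have ax : 0 < a - x.
    rewrite subr_gt0 -lte_fin; apply: lt_trans la; by case/andP: gx.
  apply: (opS_coercive_resolvent Asa Bcont (gap_neq _ gx) ax) => u Au.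
  have [u0 [u0' [hu hu' uE]]] := H0_decomposition Bran H0closed u L_gt0.
  have := sum_adjoint_le c_incr gamma gx hu hu'; rewrite -uE.
  (* Left of the zero [psi] is negative, so its term only helps and a - x remains as the coercivity
     constant. *)
  have : psi c gm gp l x * rnorm u0 ^+ 2 <= 0.
    by rewrite mulr_le0_ge0 ?sqr_ge0// ltW.
  have := Aform _ Au; rewrite mulrBl; lra.
- move=> HT; have [e [ge fe eu] el] := affine_sub_psi_unique_zero l c_incr gm0 gp0 a.
  exists e; split=> // x lxe; have gx := gap_between _ _ ge lxe.
  have ax : 0 < a - x - psi c gm gp l x by apply: el => //; case/andP: lxe.
  apply: (opS_coercive_resolvent Asa Bcont (gap_neq _ gx) ax) => u Au.
  (* With [H0] the whole space, the decomposition is u = u + 0, so [psi] multiplies |u|^2 itself and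
     no sign of [psi] is required. *)
  have hu : H0 u by rewrite HT.
  have hu' : orthocomplement H0 0 by move=> v _; exact: linear0l.
  have := sum_adjoint_le c_incr gamma gx hu hu'; rewrite addr0.
  have := Aform _ Au; rewrite !mulrBl; lra.
Qed.
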